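(* Let $f$ satisfy $(\mathcal A)$ and let $p\ge1$. Let $y_0\in\mathcal H$ and define recursively for $k\ge0$ $$\lambda_k=\|\nabla f(y_k)\|^{-\frac{p-1}{p}},\qquad y_{k+1}=\operatorname{prox}_{\lambda_k f}(y_k),$$ and assume $\nabla f(y_k)\neq0$ for all $k\ge0$. Then $f(y_{k+1})-\inf_{\mathcal H}f=o\big(k^{-(2-\frac1p)}\big)$ as $k\to+\infty$, and $(y_k)_{k\ge0}$ converges weakly to an element of $S=\operatorname{argmin} f$.
   Context: $\mathcal H$ is a real Hilbert space. Assumption $(\mathcal A)$: $f:\mathcal H\to\mathbb R$ is convex and continuously differentiable, $S=\operatorname{argmin}_{\mathcal H} f\neq\emptyset$, and $\nabla f$ is Lipschitz continuous on bounded subsets of $\mathcal H$. For $\lambda>0$, $\operatorname{prox}_{\lambda f}(y)=\operatorname{argmin}_{u\in\mathcal H}\{f(u)+\frac{1}{2\lambda}\|u-y\|^2\}$. *)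

(* Defs.v *)
From HB Require Import structures.
From mathcomp Require Import all_boot all_order all_algebra.
From mathcomp Require Import all_classical all_reals all_analysis.
Set Implicit Arguments. Unset Strict Implicit. Unset Printing Implicit Defensive.
Import Order.TTheory GRing.Theory Num.Theory.
Import numFieldNormedType.Exports.
Local Open Scope classical_set_scope.
Local Open Scope ring_scope.

(* A real inner product on a normed space H whose norm is induced by it.
   Together with H : completeNormedModType R this makes (H, ip) a real
   Hilbert space. *)
Definition is_inner_product (R : realType) (H : normedModType R)
    (ip : H -> H -> R) : Prop :=
  [/\ forall x y, ip x y = ip y x,
      forall (a : R) x y z, ip (a *: x + y) z = a * ip x z + ip y z &
      forall x, ip x x = `|x| ^+ 2].

Definition convex_fun (R : realType) (H : normedModType R) (f : H -> R) : Prop :=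
  forall (t : R) (x y : H), 0 <= t -> t <= 1 ->
    f (t *: x + (1 - t) *: y) <= t * f x + (1 - t) * f y.

Definition is_gradient (R : realType) (H : normedModType R)
    (ip : H -> H -> R) (f : H -> R) (g : H -> H) : Prop :=
  forall x, differentiable f x /\ forall v, 'd f x v = ip (g x) v.

Definition lipschitz_on_bounded (R : realType) (H : normedModType R)
    (g : H -> H) : Prop :=
  forall r : R, exists L : R, forall x y : H,
    `|x| <= r -> `|y| <= r -> `|g x - g y| <= L * `|x - y|.

Definition is_argmin (R : realType) (H : normedModType R) (f : H -> R) (x : H)
  : Prop := forall u, f x <= f u.

Definition is_prox (R : realType) (H : normedModType R) (f : H -> R)
    (lam : R) (y z : H) : Prop :=
  forall u, f z + (2 * lam)^-1 * `|z - y| ^+ 2 <= f u + (2 * lam)^-1 * `|u - y| ^+ 2.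

(* Main.v *)
(* An exact proximal step is an implicit gradient step [z = y - lam *: g z].
   Convexity makes the values, the gradient norms and the distances to any
   minimizer nonincreasing, and, at time [t k = \sum_(i < k) lam i], also the
   energy [|y k - x|^2 + 2 t k (f (y k) - f x) + (t k |g (y k)|)^2] of the
   gradient flow.  Hence [f (y k)] tends to [f x] when the step sizes are not
   summable, and weak convergence follows from Opial's lemma, weak limits along
   ultrafilters being provided by the Riesz representation theorem.
   For [lam k = |g (y k)| ^ (- a)] with [a = 1 - 1/p], the step sizes are
   nondecreasing, so that [t k >= k lam 0]; the energy then gives
   [|g (y k)| = O(1/k)], that is, [lam k >= c k^a].  As
   [\sum_k lam k (f (y k.+1) - f x)] is finite, a weighted version of Olivier's
   theorem yields the rate [o(k^-(1 + a))]. *)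
Require Import Defs.
From HB Require Import structures.
From mathcomp Require Import all_boot all_order all_algebra.
From mathcomp Require Import all_classical all_reals all_analysis.
From mathcomp Require Import ring lra zify.
Import Order.TTheory GRing.Theory Num.Theory.
Import numFieldNormedType.Exports.
Set Implicit Arguments. Unset Strict Implicit. Unset Printing Implicit Defensive.
Local Open Scope classical_set_scope.
Local Open Scope ring_scope.

(** * Inner products *)

Section InnerProduct.
Variables (R : realType) (H : normedModType R) (ip : H -> H -> R).
Hypothesis ip_inner : is_inner_product ip.
Implicit Types (u v w : H) (a : R).

Lemma ipC u v : ip u v = ip v u.
Proof. by case: ip_inner. Qed.

Lemma ipxx u : ip u u = `|u| ^+ 2.
Proof. by case: ip_inner. Qed.

Lemma ipDl u v w : ip (u + v) w = ip u w + ip v w.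
Proof. by have [_ lin _] := ip_inner; rewrite -{1}[u]scale1r lin mul1r. Qed.

Lemma ipZl a u w : ip (a *: u) w = a * ip u w.
Proof.
have ip0l : ip 0 w = 0.
  by apply: (addrI (ip 0 w)); rewrite -ipDl !addr0.
by have [_ lin _] := ip_inner; rewrite -[a *: u]addr0 lin ip0l addr0.
Qed.

Lemma ipNl u w : ip (- u) w = - ip u w.
Proof. by rewrite -scaleN1r ipZl mulN1r. Qed.

Lemma ipBl u v w : ip (u - v) w = ip u w - ip v w.
Proof. by rewrite ipDl ipNl. Qed.

Lemma ipDr u v w : ip u (v + w) = ip u v + ip u w.
Proof. by rewrite ipC ipDl !(ipC u). Qed.

Lemma ipZr a u v : ip u (a *: v) = a * ip u v.
Proof. by rewrite ipC ipZl ipC. Qed.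

Lemma ipNr u v : ip u (- v) = - ip u v.
Proof. by rewrite ipC ipNl ipC. Qed.

Lemma ipBr u v w : ip u (v - w) = ip u v - ip u w.
Proof. by rewrite ipDr ipNr. Qed.

Lemma sqr_normD u v : `|u + v| ^+ 2 = `|u| ^+ 2 + 2 * ip u v + `|v| ^+ 2.
Proof. by rewrite -!ipxx ipDl !ipDr (ipC v u); ring. Qed.

Lemma sqr_normB u v : `|u - v| ^+ 2 = `|u| ^+ 2 - 2 * ip u v + `|v| ^+ 2.
Proof. by rewrite sqr_normD ipNr normrN mulrN. Qed.

Lemma ip_le_norm u v : ip u v <= `|u| * `|v|.
Proof.
have : `|u + v| ^+ 2 <= (`|u| + `|v|) ^+ 2.
  by rewrite ler_sqr ?nnegrE ?addr_ge0// ler_normD.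
by rewrite sqr_normD sqrrD; lra.
Qed.

Lemma cauchy_schwarz u v : `|ip u v| <= `|u| * `|v|.
Proof.
by rewrite ler_norml ip_le_norm andbT lerNl -ipNl -(normrN u) ip_le_norm.
Qed.

End InnerProduct.

(** * Minimizers and the Riesz representation theorem *)

Lemma inf_range_argmin (R : realType) (H : normedModType R) (f : H -> R)
    (x : H) :
  is_argmin f x -> inf (range f) = f x.
Proof.
move=> fx_min; apply/le_anti/andP; split.
  by apply: ge_inf; [exists (f x) => _ [u _ <-] | exists x].
by apply: lb_le_inf; [exists (f x), x | move=> _ [u _ <-]].
Qed.

Section StronglyMidconvex.
Variables (R : realType) (H : completeNormedModType R) (phi : H -> R) (c : R).
Hypothesis c_gt0 : 0 < c.
Hypothesis phi_midconvex : forall u v,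
  phi (2^-1 *: (u + v)) + c * `|u - v| ^+ 2 <= (phi u + phi v) / 2.

Lemma minimizing_sequence_cauchy (m : R) (z : nat -> H) :
  (forall u, m <= phi u) -> (forall n, phi (z n) < m + harmonic n) ->
  cauchy (z @ \oo).
Proof.
move=> m_le phiz; apply: cauchy_exP => e e_gt0.
have ce2_gt0 : 0 < c * e ^+ 2 by rewrite mulr_gt0 ?exprn_gt0.
have [N _ small] := near_infty_natSinv_lt (PosNum ce2_gt0).
exists (z N), N => // n /= Nn; rewrite -ball_normE /=.
rewrite -ltr_sqr ?nnegrE ?(ltW e_gt0)// -(ltr_pM2l c_gt0).
have smallN : harmonic N < c * e ^+ 2 := small N (leqnn N).
have smalln : harmonic n < c * e ^+ 2 := small n Nn.
have := phi_midconvex (z N) (z n); have := m_le (2^-1 *: (z N + z n)).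
have := phiz N; have := phiz n; lra.
Qed.

Lemma strongly_midconvex_argmin (b : R) :
  continuous phi -> (forall u, b <= phi u) -> exists x, is_argmin phi x.
Proof.
move=> phi_cont b_le; pose m := inf (range phi).
have phi_inf : has_inf (range phi).
  by split; [exists (phi 0), 0 | exists b => _ [u _ <-]].
have m_le u : m <= phi u by apply: ge_inf; [case: phi_inf | exists u].
have /choice[z phiz] n : exists z, phi z < m + harmonic n.
  by have [_ [z _ <-] ?] := inf_adherent (harmonic_gt0 n) phi_inf; exists z.
have /cvg_ex[x zx] : cvgn z.
  by apply: cauchy_cvg; exact: minimizing_sequence_cauchy m_le phiz.
exists x => u; apply: le_trans (m_le u).
have phizx : phi (z n) @[n --> \oo] --> phi x.
  by apply: continuous_cvg zx; exact: phi_cont.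
apply: ler_cvg_to phizx _ _; last by apply: nearW => n; exact/ltW/phiz.
by rewrite -[X in _ --> X]addr0; apply: cvgD cvg_harmonic; exact: cvg_cst.
Qed.

End StronglyMidconvex.

Lemma cvg_sqr (R : realType) (T : Type) (F : set_system T) (u : T -> R)
    (l : R) :
  Filter F -> u @ F --> l -> u t ^+ 2 @[t --> F] --> l ^+ 2.
Proof. by move=> FF ul; exact: (cvg_comp _ _ ul (@exprn_continuous R 2 l)). Qed.

Lemma linear_coef_eq0 (R : realFieldType) (b d : R) :
  0 <= b -> (forall t, 0 <= 2 * t * d + t ^+ 2 * b) -> d = 0.
Proof.
move=> b_ge0 /(_ (- d / (b + 1))); have b1_gt0 : 0 < b + 1 by rewrite ltr_wpDl.
have -> : 2 * (- d / (b + 1)) * d + (- d / (b + 1)) ^+ 2 * b =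
    - (d ^+ 2 * ((b + 2) / (b + 1) ^+ 2)) by field; rewrite gt_eqF.
rewrite oppr_ge0 pmulr_lle0 ?divr_gt0 ?exprn_gt0 ?ltr_wpDl// => d2_le0.
by apply/eqP; rewrite -sqrf_eq0 eq_le d2_le0 sqr_ge0.
Qed.

Lemma riesz_representation (R : realType) (H : completeNormedModType R)
    (ip : H -> H -> R) (L : {linear H -> R^o}) :
  is_inner_product ip -> continuous L -> exists x, forall v, L v = ip x v.
Proof.
move=> ip_inner L_cont; pose phi u : R := `|u| ^+ 2 - 2 * L u.
have LZ a u : L (a *: u) = a * L u by rewrite linearZ.
have phi_cont : continuous phi.
  move=> u; apply: cvgB; first by apply: cvg_sqr; exact: norm_continuous.
  by apply: cvgM; [exact: cvg_cst | exact: L_cont].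
have [M LM] : exists M, forall u, `|L u| <= M * `|u|.
  have /linear_bounded_continuous/linear_boundedP := L_cont.
  by move=> /(@filter_ex _ _ _)-[M]; exists M.
have phi_ge u : - M ^+ 2 <= phi u.
  have := LM u; rewrite ler_norml /phi; have := sqr_ge0 (`|u| - M); lra.
have phi_mid u v :
    phi (2^-1 *: (u + v)) + 4^-1 * `|u - v| ^+ 2 <= (phi u + phi v) / 2.
  rewrite /phi normrZ exprMn (sqr_normD ip_inner) (sqr_normB ip_inner).
  rewrite LZ linearD/= ger0_norm ?invr_ge0//; lra.
have [x x_min] : exists x, is_argmin phi x.
  apply: (strongly_midconvex_argmin _ phi_mid phi_cont phi_ge).
  by rewrite invr_gt0.
exists x => v; apply/esym/subr0_eq/(linear_coef_eq0 (sqr_ge0 `|v|)) => t.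
have := x_min (x + t *: v); rewrite /phi (sqr_normD ip_inner) (ipZr ip_inner).
rewrite linearD LZ/= normrZ exprMn real_normK ?num_real//; lra.
Qed.

(** * Weak convergence along filters *)

Lemma ultra_fmap (T U : Type) (f : T -> U) (F : set_system T) :
  UltraFilter F -> UltraFilter (f @ F).
Proof.
move=> F_ultra; split=> [|G G_proper FG]; first exact: fmap_proper_filter.
apply/seteqP; split => // A GA.
have [//|FnA] := in_ultra_setVsetC (f @^-1` A) F_ultra.
have /filter_ex[x []] : G (A `&` ~` A) by apply: filterI => //; exact: FG.
by [].
Qed.

Lemma compact_ultra_cvg (T : Type) (U : topologicalType) (f : T -> U)
    (F : set_system T) (K : set U) :
  compact K -> UltraFilter F -> F (f @^-1` K) -> exists l : U, f @ F --> l.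
Proof.
rewrite compact_ultra => K_compact F_ultra FK.
by have [l [_ fl]] := K_compact _ (ultra_fmap f F_ultra) FK; exists l.
Qed.

Lemma cvg_ultraP (T : Type) (U : topologicalType) (f : T -> U)
    (F : set_system T) (l : U) : ProperFilter F ->
  (forall G, UltraFilter G -> F `<=` G -> f @ G --> l) -> f @ F --> l.
Proof.
move=> F_proper ultra_cvg V lV; apply: contrapT => nFV.
pose A := ~` (f @^-1` V).
have within_proper : ProperFilter (within A F).
  split; last exact: within_filter.
  rewrite /within/= => FA; apply: nFV.
  by apply: filterS FA => t; exact: contrapT.
have [G [G_ultra withinG]] := ultraFilterLemma within_proper.
have FG : F `<=` G by move=> B FB; apply: withinG; exact: filterS FB.
have GV : G (f @^-1` V) := ultra_cvg _ G_ultra FG V lV.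
have GA : G A by apply: withinG; exact: withinT.
by have /filter_ex[t []] : G (f @^-1` V `&` A) by exact: filterI.
Qed.

Section WeakConvergence.
Variables (R : realType) (H : normedModType R) (ip : H -> H -> R) (T : Type).
Implicit Types (F U : set_system T) (y : T -> H) (x : H).

Definition weakly_cvg F y x :=
  forall v, ip (y t) v @[t --> F] --> ip x v.

Definition weak_cluster F y x :=
  exists U, [/\ ProperFilter U, F `<=` U & weakly_cvg U y x].

Hypothesis ip_inner : is_inner_product ip.

Lemma is_cvg_ip_sub F y x x' : Filter F ->
  cvg (`|y t - x| @[t --> F]) -> cvg (`|y t - x'| @[t --> F]) ->
  cvg (ip (y t) (x - x') @[t --> F]).
Proof.
move=> FF /cvg_ex[l yx] /cvg_ex[l' yx']; apply/cvg_ex.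
exists (2^-1 * (l' ^+ 2 - l ^+ 2 - (`|x'| ^+ 2 - `|x| ^+ 2))).
have -> : (fun t => ip (y t) (x - x')) = fun t =>
    2^-1 * (`|y t - x'| ^+ 2 - `|y t - x| ^+ 2 - (`|x'| ^+ 2 - `|x| ^+ 2)).
  by apply/funext => t; rewrite !(sqr_normB ip_inner) (ipBr ip_inner); field.
apply: cvgM; first exact: cvg_cst.
by apply: cvgB; [apply: cvgB; exact: cvg_sqr | exact: cvg_cst].
Qed.

Lemma weak_cluster_unique F y x x' : ProperFilter F ->
  cvg (`|y t - x| @[t --> F]) -> cvg (`|y t - x'| @[t --> F]) ->
  weak_cluster F y x -> weak_cluster F y x' -> x = x'.
Proof.
move=> F_proper yx yx'.
have /cvg_ex[c yc] : cvg (ip (y t) (x - x') @[t --> F]) by exact: is_cvg_ip_sub.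
have ip_cluster z : weak_cluster F y z -> ip z (x - x') = c.
  move=> [U [U_proper FU yz]]; apply: (cvg_unique _ (yz _)) => //.
  by move=> V /yc; exact: FU.
move=> /ip_cluster xc /ip_cluster x'c; apply/subr0_eq/eqP.
rewrite -normr_eq0 -sqrf_eq0 -(ipxx ip_inner) (ipBl ip_inner).
by rewrite xc x'c subrr.
Qed.

End WeakConvergence.

Section Opial.
Variables (R : realType) (H : completeNormedModType R) (ip : H -> H -> R).
Hypothesis ip_inner : is_inner_product ip.
Variable T : Type.
Implicit Types (F U : set_system T) (y : T -> H).

Lemma bounded_ultra_weakly_cvg U y :
  UltraFilter U -> bounded_near y U -> exists x, weakly_cvg ip U y x.
Proof.
move=> U_ultra /ex_bound[M yM].
have ip_le v : \forall t \near U, `|ip (y t) v| <= M * `|v|.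
  apply: filterS yM => t yt; apply: le_trans (cauchy_schwarz ip_inner _ _) _.
  by rewrite ler_wpM2r.
have /choice[L ipL] v : exists l : R, ip (y t) v @[t --> U] --> l.
  have K_compact := @segment_compact R (- (M * `|v|)) (M * `|v|).
  apply: (compact_ultra_cvg K_compact U_ultra).
  by apply: filterS (ip_le v) => t; rewrite /= in_itv/= ler_norml.
have ipL_comb a u v : ip (y t) (a *: u + v) @[t --> U] --> a * L u + L v.
  under eq_fun do rewrite (ipDr ip_inner) (ipZr ip_inner).
  by apply: cvgD => //; apply: cvgM => //; exact: cvg_cst.
have L_linear : linear (L : H -> R^o).
  by move=> a u v; apply: (cvg_unique _ (ipL _) (ipL_comb a u v)).
have L_le v : `|L v| <= M * `|v|.
  by apply: cvgr_to_le (cvg_norm (ipL v)) (ip_le v).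
pose Llin : {linear H -> R^o} :=
  HB.pack (L : H -> R^o) (GRing.isLinear.Build R H R^o *:%R _ L_linear).
have [|x Lx] := riesz_representation ip_inner (L := Llin).
  apply: bounded_linear_continuous; apply/linear_boundedP.
  apply: filterS (nbhs_pinfty_ge (num_real M)) => r Mr v.
  by apply: le_trans (L_le v) _; exact: ler_wpM2r.
by exists x => v; rewrite -Lx; exact: ipL.
Qed.

Lemma opial F y (S : set H) : ProperFilter F -> S !=set0 ->
  (forall x, S x -> cvg (`|y t - x| @[t --> F])) ->
  (forall x, weak_cluster ip F y x -> S x) ->
  exists2 x, S x & weakly_cvg ip F y x.
Proof.
move=> F_proper [x0 Sx0] dist_cvg clusterS.
have y_bounded : bounded_near y F.
  have /cvg_ex[l yx0] := dist_cvg _ Sx0.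
  apply/ex_bound; exists (l + 1 + `|x0|).
  have : \forall t \near F, `|y t - x0| <= l + 1.
    by apply: cvgr_le yx0 _ _; rewrite ltrDl.
  apply: filterS => t yt.
  by rewrite /= -[y t](subrK x0) (le_trans (ler_normD _ _))// lerD2r.
have ultra_cluster U : UltraFilter U -> F `<=` U ->
    exists2 x, weakly_cvg ip U y x & weak_cluster ip F y x.
  move=> U_ultra FU.
  have [x yx] := bounded_ultra_weakly_cvg U_ultra (sub_boundedr FU y_bounded).
  by exists x => //; exists U; split=> //; exact: ultra_proper.
have [U [U_ultra FU]] := ultraFilterLemma F_proper.
have [x _ x_cluster] := ultra_cluster U U_ultra FU.
exists x; first exact: clusterS.
move=> v; apply: cvg_ultraP => G G_ultra FG.
have [x' yx' x'_cluster] := ultra_cluster G G_ultra FG.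
suff -> : x = x' by exact: yx'.
have dist_cvg_cluster z : weak_cluster ip F y z -> cvg (`|y t - z| @[t --> F]).
  by move=> /clusterS; exact: dist_cvg.
apply: (weak_cluster_unique ip_inner _ _ _ x_cluster x'_cluster);
  exact: dist_cvg_cluster.
Qed.

End Opial.

(** * Gradients of convex functions and proximal points *)

Section Gradient.
Variables (R : realType) (H : normedModType R) (ip : H -> H -> R).
Variables (f : H -> R) (g : H -> H).
Hypothesis ip_inner : is_inner_product ip.
Hypothesis f_gradient : is_gradient ip f g.
Implicit Types (x y z v : H).

Lemma gradient_cvg_at_right x v :
  t^-1 * (f (t *: v + x) - f x) @[t --> 0^'+] --> ip (g x) v.
Proof.
have [f_diff gE] := f_gradient x; apply: cvg_dnbhs_at_right.
by rewrite -gE -deriveE//; exact: diff_derivable.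
Qed.

Lemma convex_gradient_le x y : convex_fun f -> f x + ip (g x) (y - x) <= f y.
Proof.
move=> f_convex; rewrite addrC -lerBrDr.
apply: (cvgr_to_le (@gradient_cvg_at_right x (y - x))).
near=> t.
have t_gt0 : 0 < t by near: t; exact: nbhs_right_gt.
have t_le1 : t <= 1 by near: t; exact: nbhs_right_le.
have -> : t *: (y - x) + x = t *: y + (1 - t) *: x.
  by rewrite scalerBr scalerBl scale1r -addrA (addrC (- _)).
rewrite ler_pdivrMl//; have := f_convex t y x (ltW t_gt0) t_le1; lra.
Unshelve. all: by end_near. Qed.

Lemma prox_first_order (lam : R) y z v :
  is_prox f lam y z -> - (lam^-1 * ip (z - y) v) <= ip (g z) v.
Proof.
move=> z_prox.
pose slope t : R := - (lam^-1 * (ip (z - y) v + t / 2 * `|v| ^+ 2)).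
have slope_cvg : slope t @[t --> 0^'+] --> slope 0.
  apply: cvg_at_right_filter; apply: cvgN; apply: cvgM; first exact: cvg_cst.
  apply: cvgD; first exact: cvg_cst.
  by do 2![apply: cvgM; last exact: cvg_cst]; exact: cvg_id.
rewrite (_ : - _ = slope 0); last by rewrite /slope !mul0r addr0.
apply: ler_cvg_to slope_cvg (@gradient_cvg_at_right z v) _.
near=> t; have t_gt0 : 0 < t by near: t; exact: nbhs_right_gt.
rewrite /slope ler_pdivlMl//; have := z_prox (t *: v + z).
rewrite -addrA (sqr_normD ip_inner (t *: v)) (ipZl ip_inner) (ipC ip_inner v).
by rewrite normrZ exprMn real_normK ?num_real// invfM; lra.
Unshelve. all: by end_near. Qed.

Definition implicit_step (lam : R) y z := z = y - lam *: g z.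

Lemma prox_implicit_step (lam : R) y z :
  0 < lam -> is_prox f lam y z -> implicit_step lam y z.
Proof.
move=> lam_gt0 z_prox; pose w := g z + lam^-1 *: (z - y).
have /eqP : `|w| ^+ 2 = 0.
  apply/le_anti; rewrite sqr_ge0 andbT -(ipxx ip_inner) {1}/w.
  rewrite (ipDl ip_inner) (ipZl ip_inner).
  by have := prox_first_order (- w) z_prox; rewrite !(ipNr ip_inner); lra.
rewrite sqrf_eq0 normr_eq0 => /eqP w0; apply/subr0_eq.
rewrite opprB addrCA -[z - y](scalerKV (lt0r_neq0 lam_gt0)) -scalerDr -/w.
by rewrite w0 scaler0.
Qed.

Hypothesis f_convex : convex_fun f.

Lemma gradient_monotone x y : 0 <= ip (g x - g y) (x - y).
Proof.
have := convex_gradient_le x y f_convex.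
have := convex_gradient_le y x f_convex.
by rewrite -(opprB x y) (ipNr ip_inner) (ipBl ip_inner); lra.
Qed.

Lemma weakly_cvg_convex_le (T : Type) (F : set_system T) (u : T -> H) x
    (l : R) :
  ProperFilter F -> weakly_cvg ip F u x -> f (u t) @[t --> F] --> l -> f x <= l.
Proof.
move=> F_proper ux ful.
have tangent_cvg : f x + (ip (u t) (g x) - ip x (g x)) @[t --> F] --> f x.
  rewrite -[X in _ --> X]addr0 -(subrr (ip x (g x))).
  by apply: cvgD; [|apply: cvgB; [exact: ux|]]; exact: cvg_cst.
rewrite -subr_ge0; apply: (cvgr_to_ge (cvgB ful tangent_cvg)).
apply: nearW => t; rewrite subr_ge0.
by rewrite -(ipBl ip_inner) (ipC ip_inner); exact: convex_gradient_le.
Qed.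

End Gradient.

(** * The implicit gradient step *)

Section ImplicitStep.
Variables (R : realType) (H : normedModType R) (ip : H -> H -> R).
Variables (f : H -> R) (g : H -> H) (lam : R) (y z : H).
Hypothesis ip_inner : is_inner_product ip.
Hypothesis f_convex : convex_fun f.
Hypothesis f_gradient : is_gradient ip f g.
Hypothesis lam_gt0 : 0 < lam.
Hypothesis z_step : implicit_step g lam y z.

Let yE : y = z + lam *: g z.
Proof. by rewrite {1}(z_step : z = _) subrK. Qed.

Lemma implicit_step_value : f z + lam * `|g z| ^+ 2 <= f y.
Proof.
have := convex_gradient_le f_gradient z y f_convex.
by rewrite {1}yE (addrC z) addrK (ipZr ip_inner) (ipxx ip_inner).
Qed.

Lemma implicit_step_grad : `|g z| <= `|g y|.
Proof.
have := gradient_monotone ip_inner f_gradient f_convex y z.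
rewrite {2}yE (addrC z) addrK (ipZr ip_inner) pmulr_rge0// (ipBl ip_inner).
rewrite (ipxx ip_inner) subr_ge0 => /le_trans/(_ (ip_le_norm ip_inner _ _)).
have [->|gz_neq0] := eqVneq (g z) 0; first by rewrite normr0.
by rewrite expr2 ler_pM2r ?normr_gt0.
Qed.

Lemma implicit_step_dist x :
  `|z - x| ^+ 2 + 2 * lam * (f z - f x) + lam ^+ 2 * `|g z| ^+ 2
    <= `|y - x| ^+ 2.
Proof.
have -> : y - x = (z - x) + lam *: g z by rewrite {1}yE addrAC.
rewrite (sqr_normD ip_inner (z - x)) (ipZr ip_inner) (ipC ip_inner).
rewrite normrZ exprMn real_normK ?num_real// lerD2r lerD2l -mulrA ler_pM2l//.
rewrite ler_pM2l//; have := convex_gradient_le f_gradient z x f_convex.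
by rewrite -(opprB z x) (ipNr ip_inner); lra.
Qed.

(* Lyapunov function of the gradient flow [y' = - g y] at time [t]; an implicit
   step of size [lam] advances time by [lam]. *)
Definition flow_energy x (t : R) (u : H) : R :=
  `|u - x| ^+ 2 + 2 * t * (f u - f x) + (t * `|g u|) ^+ 2.

Lemma implicit_step_energy x (t : R) :
  0 <= t -> flow_energy x (t + lam) z <= flow_energy x t y.
Proof.
move=> t_ge0; rewrite /flow_energy.
have grad_le : (t * `|g z|) ^+ 2 <= (t * `|g y|) ^+ 2.
  by rewrite ler_sqr ?nnegrE ?mulr_ge0// ler_wpM2l// implicit_step_grad.
have value_le : t * (f z + lam * `|g z| ^+ 2) <= t * f y.
  by rewrite ler_wpM2l// implicit_step_value.
have := implicit_step_dist x; move: grad_le value_le; rewrite !exprMn; lra.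
Qed.

End ImplicitStep.

(** * Real sequences *)

Section RealSequences.
Variable R : realType.
Implicit Types (a : R) (u d : nat -> R) (k m : nat).

Lemma cvg_series_le_telescope u d :
  (forall k, 0 <= u k) -> (forall k, 0 <= d k) ->
  (forall k, u k <= d k - d k.+1) -> cvgn (series u).
Proof.
move=> u_ge0 d_ge0 ud; apply: nondecreasing_is_cvgn.
  exact: nondecreasing_series.
exists (d 0%N) => _ [n _ <-].
suff : series u n <= d 0%N - d n by have := d_ge0 n; lra.
elim: n => [|n IHn]; first by rewrite /series/= big_geq// subrr.
by rewrite seriesSr; have := ud n; lra.
Qed.

Lemma dyadic_block_le a u m k :
  0 <= a -> (forall n, 0 <= u n) -> nonincreasing_seq u -> (m.*2 <= k.+1)%N ->
  m%:R `^ (1 + a) * u k <=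
    series (fun n => n%:R `^ a * u n) m.*2 -
    series (fun n => n%:R `^ a * u n) m.
Proof.
move=> a_ge0 u_ge0 u_noninc mk.
have a1_neq0 : 1 + a != 0 by rewrite gt_eqF// ltr_wpDr.
rewrite powRD ?(negbTE a1_neq0)// powRr1// sub_double_series.
have -> : m%:R * m%:R `^ a * u k = \sum_(m <= n < m.*2) m%:R `^ a * u k.
  by rewrite sumr_const_nat -addnn addnK -mulrA mulr_natl.
apply: ler_sum_nat => n /andP[mn n2m].
apply: ler_pM; rewrite ?powR_ge0//.
  by rewrite ge0_ler_powR ?nnegrE// ler_nat.
by apply: u_noninc; rewrite -ltnS (leq_trans n2m).
Qed.

(* Olivier's theorem is the case [a = 0]: compare with the block [m, 2m). *)
Lemma olivier_littleo a u :
  0 <= a -> (forall n, 0 <= u n) -> nonincreasing_seq u ->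
  cvgn (series (fun n => n%:R `^ a * u n)) ->
  u =o_\oo (fun n => n%:R `^ (- (1 + a))).
Proof.
move=> a_ge0 u_ge0 u_noninc; set S := series _ => S_cvg; apply/eqoP => e e_gt0.
pose c : R := 2 `^ (1 + a).
have c_gt0 : 0 < c by rewrite powR_gt0.
have S_nondec : nondecreasing_seq S.
  by apply: nondecreasing_series => n _ _; rewrite mulr_ge0 ?powR_ge0.
have [N _ S_near] := (cvgrPdist_le _ _).1 S_cvg (e / c) (divr_gt0 e_gt0 c_gt0).
exists N.*2.+1 => // k /= k_gt; pose m := uphalf k.
have block : m%:R `^ (1 + a) * u k <= e / c.
  apply: le_trans (dyadic_block_le a_ge0 u_ge0 u_noninc _) _; first by lia.
  have := S_near m; rewrite /= ler_norml => /(_ _)/andP[|_].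
    by lia.
  by have := nondecreasing_cvgn_le S_nondec S_cvg m.*2; rewrite -/S; lra.
have k_powR_le : k%:R `^ (1 + a) <= c * m%:R `^ (1 + a).
  rewrite -powRM// -natrM ge0_ler_powR ?nnegrE ?addr_ge0// ler_nat; lia.
have k_gt0 : (0 : R) < k%:R `^ (1 + a) by rewrite powR_gt0// ltr0n; lia.
rewrite powRN normfV !ger0_norm ?powR_ge0// ler_pdivlMr// mulrC.
apply: le_trans (ler_wpM2r (u_ge0 k) k_powR_le) _.
by rewrite -mulrA mulrC -ler_pdivlMr.
Qed.

End RealSequences.

(** * The proximal point algorithm *)

Section ImplicitDescent.
Variables (R : realType) (H : normedModType R) (ip : H -> H -> R).
Variables (f : H -> R) (g : H -> H) (lam : nat -> R) (y : nat -> H).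
Hypothesis ip_inner : is_inner_product ip.
Hypothesis f_convex : convex_fun f.
Hypothesis f_gradient : is_gradient ip f g.
Hypothesis lam_gt0 : forall k, 0 < lam k.
Hypothesis y_step : forall k, implicit_step g (lam k) (y k) (y k.+1).
Implicit Types (x : H) (k : nat) (a c : R).

Lemma implicit_descent_grad_nonincreasing :
  nonincreasing_seq (fun k => `|g (y k)|).
Proof.
apply/nonincreasing_seqP => k.
exact: (implicit_step_grad ip_inner f_convex f_gradient (lam_gt0 k) (y_step k)).
Qed.

Lemma implicit_descent_value_nonincreasing :
  nonincreasing_seq (fun k => f (y k)).
Proof.
apply/nonincreasing_seqP => k.
apply: le_trans (implicit_step_value ip_inner f_convex f_gradient (y_step k)).
by rewrite lerDl mulr_ge0 ?sqr_ge0// ltW.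
Qed.

Lemma implicit_descent_gap_le_dist x k :
  2 * (lam k * (f (y k.+1) - f x)) <= `|y k - x| ^+ 2 - `|y k.+1 - x| ^+ 2.
Proof.
have := implicit_step_dist ip_inner f_convex f_gradient (lam_gt0 k)
  (y_step k) x.
have : 0 <= lam k ^+ 2 * `|g (y k.+1)| ^+ 2 by rewrite mulr_ge0 ?sqr_ge0.
lra.
Qed.

Lemma implicit_descent_dist_nonincreasing x :
  is_argmin f x -> nonincreasing_seq (fun k => `|y k - x|).
Proof.
move=> x_min; apply/nonincreasing_seqP => k.
rewrite -ler_sqr ?nnegrE// -subr_ge0.
apply: le_trans (implicit_descent_gap_le_dist x k).
by rewrite !mulr_ge0 ?subr_ge0// ltW.
Qed.

Lemma series_lam_ge0 k : 0 <= series lam k.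
Proof. by apply: sumr_ge0 => i _; exact: ltW. Qed.

Lemma implicit_descent_energy_le x k :
  flow_energy f g x (series lam k) (y k) <= `|y 0%N - x| ^+ 2.
Proof.
elim: k => [|k].
  by rewrite /series/= big_geq// /flow_energy mulr0 !mul0r expr0n !addr0.
apply: le_trans; rewrite seriesSr.
exact: (implicit_step_energy ip_inner f_convex f_gradient (lam_gt0 k) (y_step k)
  x (series_lam_ge0 k)).
Qed.

Lemma implicit_descent_gap_le x k :
  2 * series lam k * (f (y k) - f x) <= `|y 0%N - x| ^+ 2.
Proof.
apply: le_trans (implicit_descent_energy_le x k); rewrite /flow_energy.
by have := sqr_ge0 `|y k - x|; have := sqr_ge0 (series lam k * `|g (y k)|); lra.
Qed.

Lemma implicit_descent_grad_le x k :
  is_argmin f x -> series lam k * `|g (y k)| <= `|y 0%N - x|.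
Proof.
move=> x_min; rewrite -ler_sqr ?nnegrE ?mulr_ge0 ?series_lam_ge0//.
apply: le_trans (implicit_descent_energy_le x k); rewrite /flow_energy lerDr.
by rewrite addr_ge0 ?sqr_ge0// !mulr_ge0 ?series_lam_ge0// subr_ge0.
Qed.

Lemma implicit_descent_value_cvg x :
  is_argmin f x -> series lam @ \oo --> +oo -> f (y k) @[k --> \oo] --> f x.
Proof.
move=> x_min lam_dvg; apply/cvgrPdist_le => e e_gt0.
near=> k.
have lam_k_gt0 : 0 < series lam k by near: k; exact: cvgry_gt.
have : `|y 0%N - x| ^+ 2 / (2 * e) <= series lam k by near: k; exact: cvgry_ge.
rewrite ler_pdivrMr ?mulr_gt0// => lam_k_ge.
rewrite distrC ger0_norm ?subr_ge0// -(ler_pM2l lam_k_gt0).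
by have := implicit_descent_gap_le x k; lra.
Unshelve. all: by end_near. Qed.

Theorem implicit_descent_rate x a c :
  is_argmin f x -> 0 <= a -> 0 < c -> (forall k, c * k%:R `^ a <= lam k) ->
  (fun k => f (y k.+1) - f x) =o_\oo (fun k => k%:R `^ (- (1 + a))).
Proof.
move=> x_min a_ge0 c_gt0 lam_ge.
have gap_ge0 k : 0 <= f (y k) - f x by rewrite subr_ge0.
apply: olivier_littleo => //.
  by move=> m n mn; rewrite lerD2r implicit_descent_value_nonincreasing.
apply: (@cvg_series_le_telescope _ _ (fun k => `|y k - x| ^+ 2 / (2 * c))) => k.
- by rewrite mulr_ge0 ?powR_ge0.
- by rewrite divr_ge0 ?sqr_ge0// mulr_ge0// ltW.
rewrite -mulrBl ler_pdivlMr ?mulr_gt0//.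
apply: le_trans (implicit_descent_gap_le_dist x k).
have := ler_wpM2r (gap_ge0 k.+1) (lam_ge k); lra.
Qed.

End ImplicitDescent.

Theorem implicit_descent_weakly_cvg (R : realType) (H : completeNormedModType R)
    (ip : H -> H -> R) (f : H -> R) (g : H -> H) (lam : nat -> R)
    (y : nat -> H) :
  is_inner_product ip -> convex_fun f -> is_gradient ip f g ->
  (forall k, 0 < lam k) -> (forall k, implicit_step g (lam k) (y k) (y k.+1)) ->
  (exists x, is_argmin f x) -> series lam @ \oo --> +oo ->
  exists2 x, is_argmin f x & weakly_cvg ip \oo y x.
Proof.
move=> ip_inner f_convex f_gradient lam_gt0 y_step [x0 x0_min] lam_dvg.
have value_cvg := implicit_descent_value_cvg ip_inner f_convex f_gradient
  lam_gt0 y_step x0_min lam_dvg.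
apply: (opial ip_inner (S := is_argmin f)); first by exists x0.
  move=> x x_min; apply: nonincreasing_is_cvgn.
    exact: (implicit_descent_dist_nonincreasing ip_inner f_convex f_gradient
      lam_gt0 y_step).
  by exists 0 => _ [k _ <-].
move=> x [U [U_proper Uoo yx]] u; apply: le_trans (x0_min u).
apply: (weakly_cvg_convex_le ip_inner f_gradient f_convex U_proper yx).
by move=> V /value_cvg; exact: Uoo.
Qed.

(** * Step sizes that are powers of the gradient norm *)

Lemma mulr_powR_le_powRN (R : realType) (a b t x c : R) :
  0 <= a -> 0 <= b -> 0 <= t -> 0 < x -> 0 < c -> t * b * x <= c ->
  (b / c) `^ a * t `^ a <= x `^ (- a).
Proof.
move=> a_ge0 b_ge0 t_ge0 x_gt0 c_gt0 tbx_le.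
have bc_ge0 : 0 <= b / c by rewrite divr_ge0 ?(ltW c_gt0).
rewrite -mulN1r powRrM powR_inv1 ?(ltW x_gt0)// -powRM//.
rewrite ge0_ler_powR ?nnegrE ?mulr_ge0 ?invr_ge0 ?(ltW x_gt0) ?(ltW c_gt0)//.
by rewrite mulrAC ler_pdivrMr// ler_pdivlMl// mulrC (mulrC b).
Qed.

Section GradientPowerStepsize.
Variables (R : realType) (H : normedModType R) (ip : H -> H -> R).
Variables (f : H -> R) (g : H -> H) (a : R) (y : nat -> H).
Let lam k := `|g (y k)| `^ (- a).
Hypothesis ip_inner : is_inner_product ip.
Hypothesis f_convex : convex_fun f.
Hypothesis f_gradient : is_gradient ip f g.
Hypothesis a_ge0 : 0 <= a.
Hypothesis grad_neq0 : forall k, g (y k) != 0.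
Hypothesis y_step : forall k, implicit_step g (lam k) (y k) (y k.+1).

Let grad_gt0 k : 0 < `|g (y k)|.
Proof. by rewrite normr_gt0. Qed.

Let lam_gt0 k : 0 < lam k.
Proof. exact: powR_gt0. Qed.

Lemma grad_power_stepsize_ge k : lam 0%N <= lam k.
Proof.
rewrite /lam !powRN lef_pV2 ?posrE ?powR_gt0// ge0_ler_powR ?nnegrE//.
exact: (implicit_descent_grad_nonincreasing ip_inner f_convex f_gradient
  lam_gt0).
Qed.

Lemma grad_power_series_ge k : k%:R * lam 0%N <= series lam k.
Proof.
rewrite /series/= -[k in k%:R]subn0 mulr_natl -sumr_const_nat.
by apply: ler_sum => i _; exact: grad_power_stepsize_ge.
Qed.

Lemma grad_power_series_dvg : series lam @ \oo --> +oo.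
Proof.
apply/cvgryPge => A.
have := nbhs_infty_ger (A / lam 0%N); apply: filterS => k.
by rewrite ler_pdivrMr// => /le_trans; apply; exact: grad_power_series_ge.
Qed.

Lemma grad_power_stepsize_growth x :
  is_argmin f x -> exists2 c : R, 0 < c & forall k, c * k%:R `^ a <= lam k.
Proof.
move=> x_min; pose B := `|y 0%N - x|.
have grad_le k : k%:R * lam 0%N * `|g (y k)| <= B.
  apply: le_trans (ler_wpM2r _ (grad_power_series_ge k)) _ => //.
  exact: (implicit_descent_grad_le ip_inner f_convex f_gradient lam_gt0).
have B_gt0 : 0 < B by apply: lt_le_trans (grad_le 1%N); rewrite mul1r mulr_gt0.
exists ((lam 0%N / B) `^ a) => [|k]; first by rewrite powR_gt0 ?divr_gt0.
by rewrite mulr_powR_le_powRN// ltW.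
Qed.

End GradientPowerStepsize.

Theorem mainTheorem14 (R : realType) (H : completeNormedModType R)
    (ip : H -> H -> R) (f : H -> R) (g : H -> H) (p : R) (y : nat -> H) :
  is_inner_product ip ->
  convex_fun f ->
  is_gradient ip f g ->
  continuous g ->
  (exists x, is_argmin f x) ->
  lipschitz_on_bounded g ->
  1 <= p ->
  (forall k, g (y k) != 0) ->
  (forall k, is_prox f (`|g (y k)| `^ (- ((p - 1) / p))) (y k) (y k.+1)) ->
  (fun k : nat => f (y k.+1) - inf (range f))
     =o_\oo (fun k : nat => k%:R `^ (- (2 - p^-1))) /\
  exists2 x, is_argmin f x & forall v, (fun k => ip (y k) v) @ \oo --> ip x v.
Proof.
move=> ip_inner f_convex f_gradient _ [x x_min] _ p_ge1 grad_neq0 y_prox.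
have p_gt0 : 0 < p by exact: lt_le_trans p_ge1.
pose a := (p - 1) / p; pose lam k := `|g (y k)| `^ (- a).
have a_ge0 : 0 <= a by rewrite divr_ge0 ?subr_ge0// ltW.
have lam_gt0 k : 0 < lam k by rewrite powR_gt0// normr_gt0.
have y_step k : implicit_step g (lam k) (y k) (y k.+1).
  exact: (prox_implicit_step ip_inner f_gradient (lam_gt0 k) (y_prox k)).
split.
- have [c c_gt0 lam_ge] := grad_power_stepsize_growth ip_inner f_convex
    f_gradient a_ge0 grad_neq0 y_step x_min.
  rewrite (inf_range_argmin x_min).
  have -> : 2 - p^-1 = 1 + a by rewrite /a; field; rewrite gt_eqF.
  exact: (implicit_descent_rate ip_inner f_convex f_gradient lam_gt0 y_step
    x_min a_ge0 c_gt0 lam_ge).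
- apply: (implicit_descent_weakly_cvg ip_inner f_convex f_gradient lam_gt0
    y_step); first by exists x.
  exact: (grad_power_series_dvg ip_inner f_convex f_gradient a_ge0 grad_neq0
    y_step).
Qed.
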